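(* Let $p>11$ be prime, $q=p^h$, $n>3$. The Fermat curve $\mathcal{F}: X^n+Y^n=Z^n$ is nonclassical with respect to $\Sigma_3$ if and only if $p$ divides $(n-2)(n-1)(n+1)(2n-1)(n-3)(3n-1)$.
   Context: $\Sigma_3$ is the linear system of plane cubics. The function field of $\mathcal{F}$ is $\overline{\mathbb{F}}_q(x,y)$ with $x^n+y^n=1$. The order sequence $(\varepsilon_0,\dots,\varepsilon_9)$ of $\mathcal{F}$ with respect to $\Sigma_3$ is the lexicographically minimal increasing sequence of nonnegative integers with $\det(D_t^{(\varepsilon_k)}(x^iy^j))_{0\le k\le 9,\,0\le i+j\le3}\neq0$ ($t$ a separating variable, $D_t^{(r)}$ Hasse derivatives); equivalently, the common sequence, for all but finitely many $P\in\mathcal{F}$, of the 10 distinct values $I(P,\mathcal{F}\cap\mathcal{C})$ for cubics $\mathcal{C}$. $\mathcal{F}$ is classical with respect to $\Sigma_3$ if $\varepsilon_i=i$ for all $i$, nonclassical otherwise.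
   Formalization: The formal theorem also assumes that p does not divide n; otherwise X^n+Y^n-Z^n is a p-th power and the claim fails, e.g. for n = p the curve is a p-fold line, on which the cubic monomials are dependent although p does not divide the product. *)

(* Defs.v *)
From HB Require Import structures.
From mathcomp Require Import all_boot all_order all_algebra.
Set Implicit Arguments. Unset Strict Implicit. Unset Printing Implicit Defensive.
Import GRing.Theory.
Local Open Scope ring_scope.

(* The 10 exponent pairs (i,j) with i + j <= 3, i.e. the monomials x^i y^j
   spanning the linear system Sigma_3 of plane cubics (affine chart Z = 1). *)
Definition cubic_exps : seq (nat * nat) :=
  [:: (0,0); (1,0); (0,1); (2,0); (1,1); (0,2); (3,0); (2,1); (1,2); (0,3)]%N.

Definition is_closure_of_Fp (p : nat) (k : closedFieldType) : Prop :=
  p \in [pchar k] /\ forall a : k, exists m : nat, (0 < m)%N /\ a ^+ (p ^ m) = a.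

Definition transcendental_over (k : fieldType) (L : fieldType)
  (iota : {rmorphism k -> L}) (x : L) : Prop :=
  forall P : {poly k}, P != 0 -> (map_poly iota P).[x] != 0.

Definition hasse_derivatives (k : fieldType) (L : fieldType)
  (iota : {rmorphism k -> L}) (x : L) (D : nat -> L -> L) : Prop :=
  (forall a, D 0%N a = a) /\
  (forall r a b, D r (a + b) = D r a + D r b) /\
  (forall r a b, D r (a * b) = \sum_(i < r.+1) D i a * D (r - i)%N b) /\
  (forall r i a, D i (D r a) = 'C(r + i, i)%:R * D (r + i)%N a) /\
  (forall r c, (0 < r)%N -> D r (iota c) = 0) /\
  D 1%N x = 1 /\ (forall r, (1 < r)%N -> D r x = 0).

Definition cubic_wronskian (L : fieldType) (D : nat -> L -> L) (x y : L)
  : 'M[L]_10 :=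
  \matrix_(r < 10, m < 10)
     D r (x ^+ (nth (0,0)%N cubic_exps m).1 * y ^+ (nth (0,0)%N cubic_exps m).2).

(* Classical w.r.t. Sigma_3: the order sequence is (0,1,...,9), i.e. the
   determinant with epsilon_k = k is nonzero. *)
Definition classical_cubics (L : fieldType) (D : nat -> L -> L) (x y : L) : Prop :=
  \det (cubic_wronskian D x y) != 0.

(* Main.v *)
Require Import Defs.
From HB Require Import structures.
From mathcomp Require Import all_boot all_order all_algebra.
From mathcomp Require Import ring.
Import GRing.Theory.
Local Open Scope ring_scope.

(* Let K be the kernel of D 1, which contains all p-th powers. Since 10 <= p,
   the Wronskian of the ten monomials x^i y^j, i + j <= 3, vanishes as soon as they
   satisfy a nontrivial linear relation over K. If n is congruent to 1, 2, 3,
   -1, 1/2 or 1/3 mod p, then x^n + y^n = 1 yields such a relation, e.g.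
   (1 - a x - b y)^3 = 27 a b x y with a = x^(3n-1), b = y^(3n-1).

   Conversely, choose N with n N = 1 mod p. Up to a factor in K, y is the
   polynomial (1 - x^n)^N in x, so the K-span of the monomials contains
   polynomials in x, and their Wronskian can be computed in k[x]. If ten of them
   vanish at x = 0 to orders e_0, ..., e_9, its leading coefficient is a nonzero
   multiple of det C(e_c, r), which is nonzero when the e_c are distinct mod p.
   With z = 1 - (1 - x^n)^N, the polynomials x^i z^j have orders i + n j. These
   are distinct mod p unless n is one of the six values above or one of -2, 3/2,
   -1/2, 2/3; in each of the latter cases exactly two orders collide, and one
   of the two functions is replaced by a K-combination of higher order. *)

(** * Order of vanishing at zero *)

Section OrderAtZero.

Variable F : fieldType.
Implicit Types P Q R : {poly F}.

(** The order is certified by an explicit cofactor, so the zero polynomial has no order. *)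
Definition order0 (s : nat) P : Prop :=
  exists2 m : {poly F}, P = 'X^s * m & m.[0] != 0.

Lemma order0_unit P : P.[0] != 0 -> order0 0 P.
Proof. by move=> P0; exists P; rewrite ?expr0 ?mul1r. Qed.

Lemma order0M s s' P Q : order0 s P -> order0 s' Q -> order0 (s + s') (P * Q).
Proof.
move=> [m -> m0] [m' -> m'0]; exists (m * m').
  by rewrite exprD mulrACA.
by rewrite hornerM mulf_neq0.
Qed.

Lemma order0X s j P : order0 s P -> order0 (s * j) (P ^+ j).
Proof.
move=> oP; elim: j => [|j IHj].
  by rewrite muln0 expr0; apply: order0_unit; rewrite hornerC oner_neq0.
by rewrite mulnS exprS; apply: order0M.
Qed.

Lemma order0_Xn s : order0 s 'X^s.
Proof. by exists 1; rewrite ?mulr1 // hornerC oner_neq0. Qed.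

Lemma order0_addXn s r P R : (s < r)%N -> order0 s P -> order0 s (P + 'X^r * R).
Proof.
move=> lt_sr [m -> m0]; exists (m + 'X^(r - s) * R).
  by rewrite mulrDr mulrA -exprD subnKC // ltnW.
by rewrite hornerD hornerM hornerXn expr0n subn_eq0 leqNgt lt_sr mul0r addr0.
Qed.

(** ['X^s] is coprime to [U], so Gauss's lemma moves the factor ['X^s] to [P]. This clears the
    denominators that appear in the collision lemmas. *)
Lemma order0_cancel s P U : U.[0] != 0 -> order0 s (U * P) -> order0 s P.
Proof.
move=> U0 [m UPm m0].
have /dvdpP [P' defP] : 'X^s %| P.
  have copU : coprimep 'X^s U.
    by apply: coprimep_expl; rewrite coprimep_sym coprimepX.
  by rewrite -(Gauss_dvdpr P copU) UPm dvdp_mulIl.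
exists P'; first by rewrite mulrC.
have UP' : U * P' = m.
  apply: (mulfI (_ : 'X^s != 0)); first by rewrite expf_neq0 ?polyX_eq0.
  by rewrite -UPm defP; ring.
by move: m0; rewrite -UP' hornerM mulf_eq0 negb_or => /andP[].
Qed.

Lemma order0_comp_Xn n s P :
  (0 < n)%N -> order0 s P -> order0 (s * n) (P \Po 'X^n).
Proof.
move=> n0 [m -> m0]; exists (m \Po 'X^n).
  by rewrite comp_polyM comp_Xn_poly -exprM mulnC.
by rewrite horner_comp hornerXn expr0n -(negbK (n == 0%N)) -lt0n n0.
Qed.

(** The cofactor is a geometric sum of [M] terms, each equal to 1 at 0. *)
Lemma order0_1subX M : M%:R != 0 :> F -> order0 1 (1 - (1 - 'X) ^+ M).
Proof.
move=> M0; exists (\sum_(i < M) (1 - 'X) ^+ i).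
  by rewrite -opprB subrX1 -mulNr; congr (_ * _); ring.
rewrite horner_sum (eq_bigr (fun=> 1)) ?sumr_const ?card_ord // => i _.
by rewrite horner_exp !hornerE subr0 expr1n.
Qed.

End OrderAtZero.

Arguments order0 {F}.

(** * Wronskians of polynomials *)

Section FormalWronskian.

Variables (F : fieldType) (n : nat).
Hypothesis fact_neq0 : forall r, (r < n)%N -> r`!%:R != 0 :> F.

(* A relation between the rows is a polynomial of degree < n vanishing at the
   n distinct points e c; it is then zero, hence also vanishes at 0, ..., n-1,
   where the binomial matrix is unitriangular. *)
Lemma det_binomial_neq0 (e : 'I_n -> nat) :
  injective (fun c => (e c)%:R : F) ->
  \det (\matrix_(r < n, c < n) ('C(e c, r)%:R : F)) != 0.
Proof.
move=> inj_e; apply/negP => /det0P [v v0 vM].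
pose Q : {poly F} :=
  \sum_(r < n) (v 0 r / r`!%:R) *: \prod_(i < r) ('X - (i%:R)%:P).
have binQ (m : nat) : Q.[m%:R] = \sum_(r < n) v 0 r * 'C(m, r)%:R.
  rewrite horner_sum; apply: eq_bigr => r _.
  rewrite hornerZ horner_prod -mulrA; congr (_ * _).
  have -> : \prod_(i < r) ('X - (i%:R)%:P).[m%:R] = (m ^_ r)%:R :> F.
    elim: (r : nat) => [|s IHs]; first by rewrite big_ord0.
    rewrite big_ord_recr /= {}IHs ffactnSr natrM hornerXsubC.
    case: (leqP s m) => [le_sm|lt_ms]; first by rewrite natrB.
    by rewrite ffact_small // !mul0r.
  by rewrite -bin_ffact natrM mulrCA mulVf ?mulr1 ?fact_neq0.
have sizeQ : (size Q <= n)%N.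
  apply: (leq_trans (size_sum _ _ _)); apply/bigmax_leqP => r _.
  apply: (leq_trans (size_scale_leq _ _)).
  by rewrite size_prod_XsubC [index_enum _]unlock -enumT size_enum_ord.
have Q0 : Q = 0.
  apply/eqP; apply: contraTT sizeQ => Qn0; rewrite -ltnNge.
  have := @max_poly_roots _ Q [seq (e c)%:R | c <- enum 'I_n] Qn0.
  rewrite size_map size_enum_ord; apply.
    apply/allP => _ /mapP [c _ ->]; rewrite /root binQ.
    move/matrixP/(_ 0 c): vM; rewrite !mxE => vMc.
    by apply/eqP; rewrite -[RHS]vMc; apply: eq_bigr => r _; rewrite mxE.
  by rewrite map_inj_uniq ?enum_uniq.
case/negP: v0; apply/eqP/rowP => j; rewrite mxE.
have [m] := ubnP (val j); elim: m j => // m IHm j; rewrite ltnS => le_jm.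
have := binQ j; rewrite Q0 horner0 (bigD1 j) //= binn mulr1 big1 ?addr0 //.
move=> r ne_rj; case: (ltnP r j) => [lt_rj|le_jr].
  by rewrite IHm ?mul0r // (leq_trans lt_rj).
rewrite bin_small ?mulr0 // ltn_neqAle le_jr andbT eq_sym.
by rewrite (inj_eq val_inj).
Qed.

(** Multiplying row r by X^r and dividing column c by X^(e c) leaves a polynomial matrix [q]. Its
    value at 0 is the binomial matrix with column c scaled by the nonzero value of the cofactor
    [m c] at 0. *)
Lemma wronskian_nderivn_neq0 (G : 'I_n -> {poly F}) (e : 'I_n -> nat) :
  (forall c, order0 (e c) (G c)) -> injective (fun c => (e c)%:R : F) ->
  \det (\matrix_(r < n, c < n) (G c)^`N(r)) != 0.
Proof.
move=> ordG inj_e.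
have [m defG m0] : exists2 m : 'I_n -> {poly F},
    forall c, G c = 'X^(e c) * m c & forall c, (m c).[0] != 0.
  have /fin_all_exists [m Hm] c :
      exists m : {poly F}, G c = 'X^(e c) * m /\ m.[0] != 0.
    by have [m] := ordG c; exists m.
  by exists m => c; case: (Hm c).
pose q r c := \poly_(i < size (m c)) ((m c)`_i *+ 'C(e c + i, r)).
have Xq (r : nat) c : 'X^r * (G c)^`N(r) = q r c * 'X^(e c).
  apply/polyP => i; rewrite coefXnM coef_nderivn coefMXn coef_poly defG.
  case: (ltnP i r) => [lt_ir|le_ri].
    case: (ltnP i (e c)) => // le_ei.
    by rewrite subnKC // bin_small // mulr0n if_same.
  rewrite subnKC // coefXnM; case: (ltnP i (e c)) => [|le_ei].
    by rewrite mul0rn.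
  rewrite subnKC //; case: ltnP => // le_mi.
  by rewrite nth_default // mul0rn.
apply/negP => /eqP det0.
have : \det (\matrix_(r < n, c < n) q r c) = 0.
  have detE : (\prod_(r < n) 'X^r) * \det (\matrix_(r < n, c < n) (G c)^`N(r))
      = \det (\matrix_(r < n, c < n) q r c) * \prod_(c < n) 'X^(e c).
    transitivity (\det (diag_mx (\row_(r < n) ('X^r : {poly F})) *m
        \matrix_(r < n, c < n) (G c)^`N(r))).
      by rewrite det_mulmx det_diag; congr (_ * _); apply: eq_bigr => r _;
         rewrite mxE.
    transitivity (\det ((\matrix_(r < n, c < n) q r c) *m
        diag_mx (\row_(c < n) ('X^(e c) : {poly F})))).
      congr (\det _); apply/matrixP => r c.
      by rewrite mul_diag_mx mul_mx_diag !mxE Xq.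
    rewrite det_mulmx det_diag; congr (_ * _); apply: eq_bigr => c _.
    by rewrite mxE.
  move/eqP: detE; rewrite det0 mulr0 eq_sym mulf_eq0 => /orP [/eqP //|].
  rewrite prodf_seq_eq0 => /hasP [c _].
  by rewrite /= expf_eq0 polyX_eq0 andbF.
move/(congr1 (horner_eval 0)); rewrite -det_map_mx /= /horner_eval horner0.
move/eqP; apply/negP.
have -> : map_mx (horner_eval 0) (\matrix_(r < n, c < n) q r c) =
    (\matrix_(r < n, c < n) ('C(e c, r)%:R : F)) *m
    diag_mx (\row_(c < n) (m c).[0]).
  apply/matrixP => r c; rewrite mul_mx_diag !mxE /horner_eval.
  rewrite !horner_coef0 coef_poly addn0 mulr_natl.
  case: ltnP => //; rewrite leqn0 => /eqP/size0nil m_nil.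
  by move: (m0 c); rewrite horner_coef0 m_nil eqxx.
rewrite det_mulmx det_diag mulf_neq0 ?det_binomial_neq0 //.
by apply/prodf_neq0 => c _; rewrite mxE.
Qed.

End FormalWronskian.

(** * Wronskians over the field of constants *)

Section HasseDerivatives.

Variables (p : nat) (k L : fieldType) (iota : {rmorphism k -> L}) (x : L).
Variable D : nat -> L -> L.
Hypothesis charp : p \in [pchar k].
Hypothesis HD : hasse_derivatives iota x D.

Let D0 a : D 0 a = a. Proof. by case: HD. Qed.
Let Dadd r a b : D r (a + b) = D r a + D r b.
Proof. by case: HD => _ []. Qed.
Let DM r a b : D r (a * b) = \sum_(i < r.+1) D i a * D (r - i)%N b.
Proof. by case: HD => _ [_ []]. Qed.
Let D1iota c : D 1 (iota c) = 0.
Proof. by case: HD => _ [_ [_ [_ [Hc _]]]]; apply: Hc. Qed.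
Let D1x : D 1 x = 1.
Proof. by case: HD => _ [_ [_ [_ [_ []]]]]. Qed.
Let D1D r a : D 1 (D r a) = r.+1%:R * D r.+1 a.
Proof. by case: HD => _ [_ [_ [-> _]]]; rewrite addn1 bin1. Qed.

Lemma hasse0 r : D r 0 = 0.
Proof. by apply: (@addrI _ (D r 0)); rewrite -Dadd !addr0. Qed.

Lemma hasse_sum r I (s : seq I) (P : pred I) (F : I -> L) :
  D r (\sum_(i <- s | P i) F i) = \sum_(i <- s | P i) D r (F i).
Proof. exact: (big_morph _ (Dadd r) (hasse0 r)). Qed.

Lemma hasse1M a b : D 1 (a * b) = D 1 a * b + a * D 1 b.
Proof. by rewrite DM big_ord_recl big_ord1 /= !D0 addrC. Qed.

Lemma pcharL : p \in [pchar L].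
Proof. exact: rmorph_pchar charp. Qed.

Lemma natr_ltp_neq0 (R : nzRingType) r :
  p \in [pchar R] -> (0 < r < p)%N -> r%:R != 0 :> R.
Proof.
move=> chR /andP[r0 rp]; rewrite -(dvdn_pcharf chR).
by apply/negP => /(dvdn_leq r0); rewrite leqNgt rp.
Qed.

(** The kernel of the derivation [D 1] is the coefficient domain for all relations: it contains the
    p-th powers, and [D r] is linear over it for r < p. *)
Definition const (c : L) : Prop := D 1 c = 0.

Lemma constD a b : const a -> const b -> const (a + b).
Proof. by rewrite /const Dadd => -> ->; rewrite addr0. Qed.

Lemma constM a b : const a -> const b -> const (a * b).
Proof. by rewrite /const hasse1M => -> ->; rewrite mulr0 mul0r addr0. Qed.

Lemma const_iota c : const (iota c).
Proof. exact: D1iota. Qed.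

Lemma const0 : const 0.
Proof. exact: hasse0. Qed.

Lemma const1 : const 1.
Proof. by rewrite -(rmorph1 iota); apply: const_iota. Qed.

Lemma const_nat m : const m%:R.
Proof. by rewrite -(rmorph_nat iota); apply: const_iota. Qed.

Lemma constN a : const a -> const (- a).
Proof.
by move=> ca; rewrite -mulN1r -(rmorphN1 iota); apply: constM => //;
   apply: const_iota.
Qed.

Lemma constX a m : const a -> const (a ^+ m).
Proof.
move=> ca; elim: m => [|m IHm]; first by rewrite expr0; apply: const1.
by rewrite exprS; apply: constM.
Qed.

Lemma const_pow a m : (p %| m)%N -> const (a ^+ m).
Proof.
move=> /dvdnP[m' ->]; rewrite exprM /const; move: (a ^+ m') => b.
have -> : D 1 (b ^+ p) = p%:R * b ^+ p.-1 * D 1 b.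
  elim: p => [|[|r] IHr]; first by rewrite !mul0r; apply: const1.
    by rewrite expr1 expr0 !mul1r.
  by rewrite exprS hasse1M IHr /= [b ^+ r.+1]exprS -[r.+2%:R]natr1; ring.
by rewrite (pcharf0 pcharL) !mul0r.
Qed.

(** The iteration rule D 1 (D r a) = (r + 1) D (r + 1) a determines [D r] from [D 1] as long as r <
    p, since the factors r + 1 are then invertible. *)
Lemma hasse_const c r : const c -> (0 < r < p)%N -> D r c = 0.
Proof.
move=> cc; elim: r => [|[|r] IHr] //= lt_rp.
have r0 : r.+2%:R != 0 :> L by apply: natr_ltp_neq0 pcharL _.
by apply: (mulfI r0); rewrite -D1D IHr ?hasse0 ?mulr0 //= ltnW.
Qed.

Lemma hasse_constM c a r : const c -> (r < p)%N -> D r (c * a) = c * D r a.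
Proof.
move=> cc lt_rp; rewrite DM big_ord_recl D0 subn0 big1 ?addr0 // => i _.
by rewrite hasse_const ?mul0r //= (leq_trans _ lt_rp) // ltnS ltn_ord.
Qed.

Definition eval_x (P : {poly k}) : L := (map_poly iota P).[x].

Lemma hasse_eval P r : (r < p)%N -> D r (eval_x P) = eval_x P^`N(r).
Proof.
have D1eval Q : D 1 (eval_x Q) = eval_x Q^`().
  rewrite /eval_x; elim/poly_ind: Q => [|Q c IHQ].
    by rewrite deriv0 rmorph0 !horner0 hasse0.
  rewrite derivMXaddC !rmorphD !rmorphM /= map_polyX map_polyC !hornerE.
  by rewrite Dadd hasse1M IHQ D1x D1iota; ring.
elim: r => [_|r IHr lt_rp]; first by rewrite D0 nderivn0.
have r0 : r.+1%:R != 0 :> L by apply: natr_ltp_neq0 pcharL _.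
apply: (mulfI r0); rewrite -D1D IHr 1?ltnW // D1eval.
rewrite /eval_x -(rmorph_nat iota) -hornerCM -map_polyC -rmorphM /=.
congr (_.[_]); congr (map_poly _ _); apply/polyP => i.
rewrite coefCM coef_deriv !coef_nderivn addSnnS mulr_natl -!mulrnA.
by congr (_ *+ _); rewrite [RHS]mulnC mul_bin_left addKn mulnC.
Qed.

Section Family.

Variables (d : nat) (f : 'I_d -> L).
Hypothesis le_dp : (d <= p)%N.

Definition cspan (g : L) : Prop :=
  exists2 C : 'I_d -> L, forall m, const (C m) & g = \sum_m C m * f m.

Lemma cspanD a b : cspan a -> cspan b -> cspan (a + b).
Proof.
move=> [A cA ->] [B cB ->]; exists (fun m => A m + B m).
  by move=> m; apply: constD.
by rewrite -big_split; apply: eq_bigr => m _; rewrite mulrDl.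
Qed.

Lemma cspanM c a : const c -> cspan a -> cspan (c * a).
Proof.
move=> cc [A cA ->]; exists (fun m => c * A m).
  by move=> m; apply: constM.
by rewrite mulr_sumr; apply: eq_bigr => m _; rewrite mulrA.
Qed.

Lemma cspan_sum I (r : seq I) (F : I -> L) :
  (forall i, cspan (F i)) -> cspan (\sum_(i <- r) F i).
Proof.
move=> sF; apply: big_ind => // [|a b]; last exact: cspanD.
exists (fun=> 0) => [_|]; first exact: const0.
by rewrite big1 // => m; rewrite mul0r.
Qed.

Lemma cspan_mem m : cspan (f m).
Proof.
exists (fun m' => (m' == m)%:R); first by move=> m'; apply: const_nat.
rewrite (bigD1 m) //= eqxx mul1r big1 ?addr0 // => m' /negPf ->.
by rewrite mul0r.
Qed.

(** Every row index is below p, so each [D r] preserves the relation, which becomes a dependency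
    between the columns. *)
Lemma wronskian_relation_eq0 (C : 'I_d -> L) m0 :
  (forall m, const (C m)) -> C m0 != 0 -> \sum_m C m * f m = 0 ->
  \det (\matrix_(r < d, m < d) D r (f m)) = 0.
Proof.
move=> cC Cm0 rel; rewrite -det_tr; apply/eqP/det0P.
exists (\row_m C m).
  by apply: contraNneq Cm0 => /rowP/(_ m0); rewrite !mxE => /eqP.
apply/rowP => r; rewrite !mxE -[RHS](hasse0 r) -[in RHS]rel hasse_sum.
apply: eq_bigr => m _; rewrite !mxE hasse_constM //.
exact: leq_trans (ltn_ord r) le_dp.
Qed.

(** The formal Wronskian of the [G c], evaluated at x, is the Wronskian of [f] times the matrix of
    coefficients. It is nonzero as a polynomial, hence nonzero at the transcendental x. *)
Lemma wronskian_neq0 (G : 'I_d -> {poly k}) (e : 'I_d -> nat) :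
  transcendental_over iota x ->
  (forall c, cspan (eval_x (G c))) -> (forall c, order0 (e c) (G c)) ->
  injective (fun c => (e c)%:R : k) ->
  \det (\matrix_(r < d, m < d) D r (f m)) != 0.
Proof.
move=> trx sG oG inj_e.
have [C cC defG] : exists2 C : 'I_d -> 'I_d -> L,
    forall c m, const (C c m) &
    forall c, eval_x (G c) = \sum_m C c m * f m.
  have /fin_all_exists [C HC] c : exists C : 'I_d -> L,
      (forall m, const (C m)) /\ eval_x (G c) = \sum_m C m * f m.
    by have [C] := sG c; exists C.
  by exists C => c; case: (HC c).
have ltp (r : 'I_d) : (r < p)%N by apply: leq_trans (ltn_ord r) le_dp.
have fact0 r : (r < d)%N -> r`!%:R != 0 :> k.
  move=> lt_rd; rewrite -(dvdn_pcharf charp).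
  have : (r < p)%N by apply: leq_trans lt_rd le_dp.
  elim: r {lt_rd} => [_|r IHr lt_rp].
    by rewrite fact0 dvdn1 neq_ltn prime_gt1 ?orbT // (pcharf_prime charp).
  rewrite factS (Euclid_dvdM _ _ (pcharf_prime charp)) negb_or IHr 1?ltnW //.
  by rewrite gtnNdvd.
have := wronskian_nderivn_neq0 _ _ fact0 _ _ oG inj_e => /trx.
pose phi : {rmorphism {poly k} -> L} := horner_eval x \o map_poly iota.
rewrite -[_.[x]]/(phi _) -det_map_mx.
have -> : map_mx phi (\matrix_(r < d, c < d) (G c)^`N(r)) =
    (\matrix_(r < d, m < d) D r (f m)) *m \matrix_(m < d, c < d) C c m.
  apply/matrixP => r c; rewrite !mxE -[LHS]/(eval_x _) -hasse_eval //.
  rewrite defG hasse_sum; apply: eq_bigr => m _.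
  by rewrite !mxE hasse_constM // mulrC.
by rewrite det_mulmx mulf_eq0 negb_or => /andP[].
Qed.

End Family.

End HasseDerivatives.

(** * The four colliding pairs of orders *)

Section TruncatedSeries.

Variables (p : nat) (F : fieldType).
Hypothesis charp : p \in [pchar F].

Lemma pchar_natr_eq1 a : a%:R = 1 :> F -> exists m, a = (1 + p * m)%N.
Proof.
case: a => [/esym/eqP|a]; first by rewrite oner_eq0.
rewrite -natr1 => /(canRL (addrK 1))/eqP; rewrite subrr -(dvdn_pcharf charp).
by case/dvdnP => m ->; exists m; rewrite mulnC.
Qed.

Lemma pchar_natr_inv a : a%:R != 0 :> F -> exists M, (a * M)%:R = 1 :> F.
Proof.
(* Fermat's little theorem, in the form that Frobenius fixes the image of every natural number. *)
move=> a0; exists (a ^ (p - 2))%N; apply: (mulfI a0); rewrite mulr1.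
rewrite -expnS -natrM -expnS -subSn ?subSS ?prime_gt1 ?(pcharf_prime charp) //.
rewrite subn1 prednK ?prime_gt0 ?(pcharf_prime charp) //.
by rewrite natrX -(pFrobenius_autE charp) pFrobenius_aut_nat.
Qed.

(** Frobenius gives (1 - X)^p = 1 - X^p. Hence, up to O(X^p), powers of 1 - X depend only on the
    exponent mod p. *)
Lemma expr1subX_pchar m :
  exists R : {poly F}, (1 - 'X) ^+ (p * m) = 1 + 'X^p * R.
Proof.
have char_poly : p \in [pchar {poly F}] by rewrite pchar_poly.
rewrite exprM -(pFrobenius_autE char_poly) pFrobenius_autB_comm; last first.
  exact: commr_sym (commr1 _).
rewrite pFrobenius_aut1 pFrobenius_autE.
elim: m => [|m [R IHm]]; first by exists 0; rewrite expr0 mulr0 addr0.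
by exists (R - 1 - 'X^p * R); rewrite exprS IHm; ring.
Qed.

Lemma expr1subX_eq1 a : a%:R = 1 :> F ->
  exists R : {poly F}, 'X = 1 - (1 - 'X) ^+ a + 'X^p * R.
Proof.
case/pchar_natr_eq1 => m ->; have [R defR] := expr1subX_pchar m.
by exists ((1 - 'X) * R); rewrite exprD defR; ring.
Qed.

(** Target form of the collision lemmas: with w = (1 - X)^M, the factor 1 - w has order 1, and its
    cofactor has the nonzero value [C] at 0. *)
Lemma order0_lead M s r (C : nat) (Q R : {poly F}) :
  M%:R != 0 :> F -> C%:R != 0 :> F -> (s < r)%N ->
  order0 s ((1 - (1 - 'X) ^+ M) ^+ s * (C%:R + (1 - (1 - 'X) ^+ M) * Q)
          + 'X^r * R).
Proof.
move=> M0 C0 lt_sr; apply: order0_addXn lt_sr _.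
rewrite -[s in order0 s]addn0; apply: order0M.
  by rewrite -[s in order0 s]mul1n; apply: order0X; apply: order0_1subX.
apply: order0_unit; rewrite -polyC_natr !hornerE subr0.
by rewrite expr1n subrr mul0r addr0.
Qed.

End TruncatedSeries.

(* In each of the four lemmas below, writing w for (1 - 'X)^M, the variable and
   Z are rational functions of w up to O('X^p), so that the claim becomes an
   identity between polynomials in t = 1 - w. *)
Section Collisions.

Variables (p : nat) (F : fieldType) (M : nat).
Hypotheses (charp : p \in [pchar F]) (p_gt11 : (11 < p)%N).

Let natr0 r : (0 < r < 12)%N -> r%:R != 0 :> F.
Proof.
move=> /andP[r0 rp]; apply: (natr_ltp_neq0 p) => //.
by rewrite r0 (leq_trans rp).
Qed.

Let natrM0 a b : (a * b)%:R = 1 :> F -> b%:R != 0 :> F.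
Proof.
move=> ab; apply: contra_eq_neq ab => b0.
by rewrite natrM b0 mulr0 eq_sym oner_neq0.
Qed.

Let p_gt0 : (0 < p)%N.
Proof. exact: leq_trans p_gt11. Qed.

Let w0 : ((1 - 'X) ^+ M : {poly F}).[0] = 1.
Proof. by rewrite horner_exp !hornerE subr0 expr1n. Qed.

Lemma order0_collision_m2 (Z := 1 - (1 - 'X) ^+ (M * p.-1) : {poly F}) :
  (2 * M)%:R = 1 :> F ->
  order0 5 (8 * 'X + 16 * Z - 12 * 'X * Z + 2 * 'X * Z ^+ 2 + 'X * Z ^+ 3).
Proof.
move=> M2; set B := (X in order0 5 X).
(* Up to O(X^p), 2 M = 1 gives X = 1 - w^2, and the exponent M (p - 1), which is -M mod p, gives w Z
   = w - 1. *)
have [r1] := expr1subX_eq1 _ _ charp _ M2.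
have [r2] := expr1subX_pchar _ _ charp M.
have -> : (p * M = M + M * p.-1)%N.
  by rewrite mulnC -[in LHS](prednK p_gt0) mulnS.
pose w : {poly F} := (1 - 'X) ^+ M.
rewrite exprD -/w [(2 * M)%N]mulnC [_ ^+ (M * 2)]exprM -/w => wY eX.
pose e : {poly F} := 'X^p; rewrite -/e in wY eX.
have wZ : w * Z = w - 1 - e * r2 by rewrite /Z mulrBr wY; ring.
have [R defB] : exists R, - w ^+ 3 * B =
    (1 - w) ^+ 5 * (1%:R + (1 - w) * 0) + e * R.
  have -> : - w ^+ 3 * B = - (16 * w ^+ 2 * (w * Z) - 'X *
      (- 8 * w ^+ 3 + 12 * w ^+ 2 * (w * Z) - 2 * w * (w * Z) ^+ 2
        - (w * Z) ^+ 3)) by rewrite /B; ring.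
  rewrite wZ; move: eX; move: {wY wZ B Z} (e) => e' ->.
  (* [A] is w Z and [A0] its value modulo X^p. The witness uses the quotients of A^2 - A0^2 and A^3
     - A0^3 by A - A0 = - e' r2. *)
  set A := w - 1 - e' * r2; set A0 := w - 1.
  exists (- (16 * w ^+ 2 * - r2 - r1 *
   (- 8 * w ^+ 3 + 12 * w ^+ 2 * A - 2 * w * A ^+ 2 - A ^+ 3) + (1 - w ^+ 2) *
   r2 * (12 * w ^+ 2 - 2 * w * (A + A0) - (A ^+ 2 + A * A0 + A0 ^+ 2)))).
  by rewrite /A /A0; ring.
apply: (@order0_cancel _ _ _ (- w ^+ 3)).
  by rewrite hornerN horner_exp w0 expr1n oppr_eq0 oner_neq0.
rewrite defB; apply: order0_lead.
- exact: natrM0 M2.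
- exact: oner_neq0.
- exact: leq_trans p_gt11.
Qed.

Lemma order0_collision_3half (Z := 1 - (1 - 'X) ^+ (M * 2) : {poly F}) :
  (3 * M)%:R = 1 :> F -> order0 4 (18 * Z ^+ 2 - 9 * Z ^+ 3 - 8 * 'X ^+ 2).
Proof.
move=> M3; set B := (X in order0 4 X).
(* Here X = 1 - w^3 up to O(X^p), while Z = 1 - w^2 holds exactly. *)
have [r1] := expr1subX_eq1 _ _ charp _ M3.
rewrite mulnC /B /Z !exprM; set w := (1 - 'X) ^+ M => eX.
have -> : 18 * (1 - w ^+ 2) ^+ 2 - 9 * (1 - w ^+ 2) ^+ 3 - 8 * 'X ^+ 2 =
    (1 - w) ^+ 4 * (6%:R + (1 - w) * (- 6 + (1 - w))) +
    'X^p * (- 8 * r1 * ('X + (1 - w ^+ 3))).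
  move: eX; move: ('X^p) => e eX.
  have -> : e * (- 8 * r1 * ('X + (1 - w ^+ 3))) =
    - 8 * (('X - (1 - w ^+ 3)) * ('X + (1 - w ^+ 3))).
    have -> : 'X - (1 - w ^+ 3) = e * r1 by rewrite {1}eX; ring.
    by ring.
  by ring.
apply: order0_lead; [exact: natrM0 M3 | exact: natr0 | exact: leq_trans p_gt11].
Qed.

Lemma order0_collision_mhalf (Z := 1 - (1 - 'X) ^+ (2 * p.-1) : {poly F}) :
  order0 6 (8 * Z ^+ 2 - 'X ^+ 2 * (32 - 48 * Z + 14 * Z ^+ 2 + Z ^+ 3)).
Proof.
set B := (X in order0 6 X).
have [r2] := expr1subX_pchar _ _ charp 2.
have -> : (p * 2 = 2 + 2 * p.-1)%N.
  by rewrite mulnC -[in LHS](prednK p_gt0) mulnS.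
(* Here w = 1 - X; the exponent 1 is kept to match [order0_lead] with M = 1. Up to O(X^p), Z = 1 -
   w^(-2), whence the factor w^6 below. *)
have X1 : 'X = 1 - (1 - 'X) ^+ 1 :> {poly F} by rewrite expr1; ring.
rewrite exprD; move: X1; set w := (1 - 'X) ^+ 1.
have -> : (1 - 'X) ^+ 2 = w ^+ 2 by rewrite /w expr1.
pose e : {poly F} := 'X^p; rewrite -/e => eX wY.
have wZ : w ^+ 2 * Z = w ^+ 2 - 1 - e * r2 by rewrite /Z mulrBr wY; ring.
have [R defB] : exists R, w ^+ 6 * B =
    (1 - w) ^+ 6 * (6%:R + (1 - w) * (- 6 + (1 - w))) + e * R.
  have -> : w ^+ 6 * B = 8 * w ^+ 2 * (w ^+ 2 * Z) ^+ 2 - 'X ^+ 2 *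
      (32 * w ^+ 6 - 48 * w ^+ 4 * (w ^+ 2 * Z)
        + 14 * w ^+ 2 * (w ^+ 2 * Z) ^+ 2 + (w ^+ 2 * Z) ^+ 3).
    by rewrite /B; ring.
  rewrite wZ; move: eX; move: {wY wZ B Z} (e) => e' ->.
  set A := w ^+ 2 - 1 - e' * r2; set A0 := w ^+ 2 - 1.
  exists (- r2 * (8 * w ^+ 2 * (A + A0) - (1 - w) ^+ 2 *
     (- 48 * w ^+ 4 + 14 * w ^+ 2 * (A + A0) + A ^+ 2 + A * A0 + A0 ^+ 2))).
  by rewrite /A /A0; ring.
apply: (@order0_cancel _ _ _ (w ^+ 6)).
  by rewrite /w expr1 horner_exp !hornerE subr0 expr1n oner_neq0.
rewrite defB; apply: order0_lead.
- exact: oner_neq0.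
- exact: natr0.
- exact: leq_trans p_gt11.
Qed.

Lemma order0_collision_2third (Z := 1 - (1 - 'X) ^+ (M * 3) : {poly F}) :
  (2 * M)%:R = 1 :> F ->
  order0 5 (54 * 'X ^+ 3 - 16 * Z ^+ 3 - 27 * 'X ^+ 3 * Z).
Proof.
move=> M2; set B := (X in order0 5 X).
have [r1] := expr1subX_eq1 _ _ charp _ M2.
rewrite mulnC /B /Z !exprM; set w := (1 - 'X) ^+ M => eX.
have -> : 54 * 'X ^+ 3 - 16 * (1 - w ^+ 3) ^+ 3
      - 27 * 'X ^+ 3 * (1 - w ^+ 3) =
    (1 - w) ^+ 5 * (216%:R + (1 - w) * (- 432 + 315 * (1 - w)
       - 99 * (1 - w) ^+ 2 + 11 * (1 - w) ^+ 3)) +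
    'X^p * (r1 * ('X ^+ 2 + 'X * (1 - w ^+ 2) + (1 - w ^+ 2) ^+ 2)
            * (54 - 27 * (1 - w ^+ 3))).
  move: eX; move: ('X^p) => e eX.
  have -> : e * (r1 * ('X ^+ 2 + 'X * (1 - w ^+ 2) + (1 - w ^+ 2) ^+ 2)
            * (54 - 27 * (1 - w ^+ 3))) =
    ('X - (1 - w ^+ 2)) * ('X ^+ 2 + 'X * (1 - w ^+ 2) + (1 - w ^+ 2) ^+ 2)
            * (54 - 27 * (1 - w ^+ 3)).
    have -> : 'X - (1 - w ^+ 2) = e * r1 by rewrite {1}eX; ring.
    by ring.
  by ring.
apply: order0_lead; [exact: natrM0 M2 | | exact: leq_trans p_gt11].
by rewrite (_ : 216 = 6 * 6 * 6)%N // !natrM !mulf_neq0 ?natr0.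
Qed.

End Collisions.

(** * Cubics on the Fermat curve *)

Section FermatCurve.

Variables (p n : nat) (k L : fieldType) (iota : {rmorphism k -> L}).
Variables (x y : L) (D : nat -> L -> L).
Hypotheses (charp : p \in [pchar k]) (p_gt11 : (11 < p)%N) (n_gt3 : (3 < n)%N).
Hypothesis curve : x ^+ n + y ^+ n = 1.
Hypothesis trx : transcendental_over iota x.
Hypothesis HD : hasse_derivatives iota x D.

Let n_gt0 : (0 < n)%N.
Proof. exact: leq_trans n_gt3. Qed.

Let le10p : (10 <= p)%N.
Proof. exact: leq_trans p_gt11. Qed.

Let cD := constD _ _ _ _ _ HD.
Let cN := constN _ _ _ _ _ HD.
Let cM := constM _ _ _ _ _ HD.
Let cX := constX _ _ _ _ _ HD.
Let cnat := const_nat _ _ _ _ _ HD.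
Let cpow := const_pow _ _ _ _ _ _ charp HD.

Ltac constants :=
  repeat first [ assumption | exact: (cnat 0) | exact: (cnat 1)
               | apply: cnat | apply: cN | apply: cD | apply: cX | apply: cM ].

(** * Constant relations between the cubic monomials *)

Definition cubic_monomial (m : 'I_10) : L :=
  x ^+ (nth (0, 0)%N cubic_exps m).1 * y ^+ (nth (0, 0)%N cubic_exps m).2.

Lemma cubic_relation_nonclassical (c00 c10 c01 c20 c11 c02 c30 c21 c12 c03 : L)
    (cs := [:: c00; c10; c01; c20; c11; c02; c30; c21; c12; c03]) (m : 'I_10) :
  (forall i : 'I_10, const _ D cs`_i) -> cs`_m != 0 ->
  c00 + c10 * x + c01 * y + c20 * x ^+ 2 + c11 * x * y + c02 * y ^+ 2
    + c30 * x ^+ 3 + c21 * x ^+ 2 * y + c12 * x * y ^+ 2 + c03 * y ^+ 3 = 0 ->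
  ~ classical_cubics D x y.
Proof.
move=> cc cm rel; apply/negP/negPn/eqP.
apply: (wronskian_relation_eq0 _ _ _ _ _ _ charp HD _ cubic_monomial le10p
  (fun m => cs`_m) m) => //.
by rewrite !big_ord_recl big_ord0 /cubic_monomial /= -[RHS]rel; ring.
Qed.


(** When m = d mod p, a^m is a constant times a^d. In each case the curve equation thus yields a
    line, conic or cubic with constant coefficients through (x, y). *)
Lemma fermat_nonclassical :
  [\/ p %| n - 1, p %| n - 2 | p %| n - 3]%N \/
  [\/ p %| n + 1, p %| 2 * n - 1 | p %| 3 * n - 1]%N ->
  ~ classical_cubics D x y.
Proof.
move=> dvd.
have pow m d : (p %| m - d)%N -> (d <= m)%N -> forall a : L,
    const _ D (a ^+ (m - d)) /\ a ^+ m = a ^+ (m - d) * a ^+ d.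
  by move=> dv le a; split; [apply: cpow | rewrite -exprD subnK].
case: dvd => [[] dv|[] dv].
- have [cx ex] := pow _ _ dv n_gt0 x.
  have [cy ey] := pow _ _ dv n_gt0 y.
  move: curve; rewrite {}ex {}ey.
  move: (x ^+ (n - 1)) (y ^+ (n - 1)) cx cy => a b ca cb rel.
  apply: (cubic_relation_nonclassical (-1)
    a b 0 0 0 0 0 0 0 (Ordinal (isT : 0 < 10)%N)).
  + by case=> -[|[|[|[|[|[|[|[|[|[|i]]]]]]]]]] //= _; constants.
  + by rewrite /= oppr_eq0 oner_neq0.
  + by rewrite -[RHS](subrr 1) -{2}rel; ring.
- have [cx ex] := pow _ _ dv (ltnW (ltnW n_gt3)) x.
  have [cy ey] := pow _ _ dv (ltnW (ltnW n_gt3)) y.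
  move: curve; rewrite {}ex {}ey.
  move: (x ^+ (n - 2)) (y ^+ (n - 2)) cx cy => a b ca cb rel.
  apply: (cubic_relation_nonclassical (-1)
    0 0 a 0 b 0 0 0 0 (Ordinal (isT : 0 < 10)%N)).
  + by case=> -[|[|[|[|[|[|[|[|[|[|i]]]]]]]]]] //= _; constants.
  + by rewrite /= oppr_eq0 oner_neq0.
  + by rewrite -[RHS](subrr 1) -{2}rel; ring.
- have [cx ex] := pow _ _ dv (ltnW n_gt3) x.
  have [cy ey] := pow _ _ dv (ltnW n_gt3) y.
  move: curve; rewrite {}ex {}ey.
  move: (x ^+ (n - 3)) (y ^+ (n - 3)) cx cy => a b ca cb rel.
  apply: (cubic_relation_nonclassical (-1)
    0 0 0 0 0 a 0 0 b (Ordinal (isT : 0 < 10)%N)).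
  + by case=> -[|[|[|[|[|[|[|[|[|[|i]]]]]]]]]] //= _; constants.
  + by rewrite /= oppr_eq0 oner_neq0.
  + by rewrite -[RHS](subrr 1) -{2}rel; ring.
(* The relation is x y (x^n + y^n - 1) = 0, where x^(n+1) and y^(n+1) are constants. *)
- have cx := cpow x _ dv; have cy := cpow y _ dv.
  apply: (cubic_relation_nonclassical 0 (y ^+ (n + 1)) (x ^+ (n + 1)) 0 (-1)
    0 0 0 0 0 (Ordinal (isT : 4 < 10)%N)).
  + by case=> -[|[|[|[|[|[|[|[|[|[|i]]]]]]]]]] //= _; constants.
  + by rewrite /= oppr_eq0 oner_neq0.
  + transitivity (x * y * (x ^+ n + y ^+ n - 1)); first by rewrite !exprD; ring.
    by rewrite curve subrr mulr0.
(* With A = x^n, a x = A^2 and b y = (1 - A)^2; eliminating A gives the conic 1 - 2 (a x + b y) + (a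
   x - b y)^2 = 0. *)
- have le : (1 <= 2 * n)%N by rewrite muln_gt0.
  have [cx ex] := pow _ _ dv le x; have [cy ey] := pow _ _ dv le y.
  rewrite expr1 {1}mulnC exprM in ex; rewrite expr1 {1}mulnC exprM in ey.
  have eB : y ^+ n = 1 - x ^+ n by rewrite -curve addrC addKr.
  move: ex ey; rewrite {}eB; move: (x ^+ n) => A.
  move: (x ^+ (2 * n - 1)) (y ^+ (2 * n - 1)) cx cy => a b ca cb ex ey.
  apply: (cubic_relation_nonclassical 1 (- 2 * a) (- 2 * b) (a ^+ 2)
    (- 2 * a * b) (b ^+ 2) 0 0 0 0 (Ordinal (isT : 0 < 10)%N)).
  + by case=> -[|[|[|[|[|[|[|[|[|[|i]]]]]]]]]] //= _; constants.
  + by rewrite /= oner_neq0.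
  + transitivity (1 - 2 * (a * x) - 2 * (b * y) + (a * x) ^+ 2
      - 2 * (a * x) * (b * y) + (b * y) ^+ 2); first by ring.
    by rewrite -ex -ey; ring.
(* Now a x = A^3 and b y = (1 - A)^3, so 1 - a x - b y = 3 A (1 - A), and cubing eliminates A. *)
- have le : (1 <= 3 * n)%N by rewrite muln_gt0.
  have [cx ex] := pow _ _ dv le x; have [cy ey] := pow _ _ dv le y.
  rewrite expr1 {1}mulnC exprM in ex; rewrite expr1 {1}mulnC exprM in ey.
  have eB : y ^+ n = 1 - x ^+ n by rewrite -curve addrC addKr.
  move: ex ey; rewrite {}eB; move: (x ^+ n) => A.
  move: (x ^+ (3 * n - 1)) (y ^+ (3 * n - 1)) cx cy => a b ca cb ex ey.
  apply: (cubic_relation_nonclassical 1 (- 3 * a) (- 3 * b) (3 * a ^+ 2)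
    (- 21 * a * b) (3 * b ^+ 2) (- a ^+ 3) (- 3 * a ^+ 2 * b)
    (- 3 * a * b ^+ 2) (- b ^+ 3) (Ordinal (isT : 0 < 10)%N)).
  + by case=> -[|[|[|[|[|[|[|[|[|[|i]]]]]]]]]] //= _; constants.
  + by rewrite /= oner_neq0.
  + transitivity ((1 - a * x - b * y) ^+ 3 - 27 * (a * x) * (b * y)).
      by ring.
    by rewrite -ex -ey; ring.
Qed.

(** * Polynomials in x spanned by the cubics over the constants *)

Lemma cspan_monomial i j : (i + j <= 3)%N ->
  cspan _ D _ cubic_monomial (x ^+ i * y ^+ j).
Proof.
move=> le3; have ij : (i, j) \in cubic_exps.
  by case: i j le3 => [|[|[|[|i]]]] [|[|[|[|j]]]].
have lt10 : (index (i, j) cubic_exps < 10)%N.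
  by rewrite -[10%N]/(size cubic_exps) index_mem.
have := cspan_mem _ _ _ _ _ HD _ cubic_monomial (Ordinal lt10).
by rewrite /cubic_monomial /= nth_index.
Qed.

Section Chart.

Variable N : nat.
Hypothesis nN : (n * N)%:R = 1 :> k.

(** Written as a composite with X^n so that orders can be computed in the variable x^n. *)
Definition chart_z : {poly k} := (1 - (1 - 'X) ^+ N) \Po 'X^n.

(** This is 1 - y^(nN), split to show y with a coefficient that is constant because nN = 1 mod p. *)
Let z : L := 1 - y ^+ (n * N).-1 * y.

Lemma eval_chart_z : eval_x _ _ iota x chart_z = z.
Proof.
have [m nNm] := pchar_natr_eq1 _ _ charp _ nN.
rewrite /eval_x /chart_z map_comp_poly map_polyXn horner_comp hornerXn.
rewrite rmorphB rmorphXn rmorphB /= !rmorph1 map_polyX !hornerE.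
have -> : 1 - x ^+ n = y ^+ n by rewrite -curve addrC addKr.
by rewrite -exprM /z -exprSr prednK // nNm.
Qed.

Let const_c : const _ D (y ^+ (n * N).-1).
Proof.
have [m nNm] := pchar_natr_eq1 _ _ charp _ nN.
by apply: cpow; rewrite nNm add1n dvdn_mulr.
Qed.

Lemma cspan_chart i j : (i + j <= 3)%N ->
  cspan _ D _ cubic_monomial (x ^+ i * z ^+ j).
Proof.
move=> le3; rewrite /z exprDn mulr_sumr; apply: (cspan_sum _ _ _ _ _ HD) => l.
rewrite expr1n mul1r exprNn exprMn.
have -> : x ^+ i * ((-1) ^+ l * (y ^+ (n * N).-1 ^+ l * y ^+ l) *+ 'C(j, l)) =
    ((-1) ^+ l * y ^+ (n * N).-1 ^+ l * 'C(j, l)%:R) * (x ^+ i * y ^+ l).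
  by rewrite -mulr_natl; ring.
apply: (cspanM _ _ _ _ _ HD); first by constants.
by apply: cspan_monomial; apply: leq_trans le3; rewrite leq_add2l -ltnS.
Qed.

(* The basis x^i z^j of the cubics has orders i + n j at x = 0; one member may
   be replaced by another cubic G0 with constant coefficients. *)
Lemma fermat_classical (m0 : 'I_10) (G0 : {poly k}) (e0 : nat * nat)
    (e := fun c : 'I_10 => if c == m0 then e0 else nth (0, 0)%N cubic_exps c) :
  cspan _ D _ cubic_monomial (eval_x _ _ iota x G0) ->
  order0 (e0.1 + e0.2 * n) G0 ->
  injective (fun c : 'I_10 => (e c).1%:R + (e c).2%:R * n%:R : k) ->
  classical_cubics D x y.
Proof.
move=> sG0 oG0 inj_e.
pose G c := if c == m0 then G0 else 'X^((e c).1) * chart_z ^+ (e c).2.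
have N0 : N%:R != 0 :> k.
  by apply: contra_eq_neq nN => N0; rewrite natrM N0 mulr0 eq_sym oner_neq0.
apply: (wronskian_neq0 _ _ _ _ _ _ charp HD _ cubic_monomial le10p G
  (fun c => (e c).1 + (e c).2 * n)%N) => //.
- move=> c; rewrite /G /e; case: (c == m0) => //.
  rewrite /eval_x rmorphM !rmorphXn /= map_polyX hornerM !horner_exp hornerX.
  rewrite -[_.[x] in X in cspan _ _ _ _ X]/(eval_x _ _ _ _ _) eval_chart_z.
  by apply: cspan_chart; case: c => -[|[|[|[|[|[|[|[|[|[|m]]]]]]]]]].
- move=> c; rewrite /G /e; case: (c == m0) => //.
  apply: order0M; first exact: order0_Xn.
  rewrite mulnC; apply: order0X; rewrite -[n in order0 n]mul1n.
  by apply: order0_comp_Xn => //; apply: order0_1subX.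
- by move=> c c' /=; rewrite !natrD !natrM => /inj_e.
Qed.

End Chart.

(** * Distinctness of orders modulo p *)

Lemma natr_inj_ltp a b :
  (a < p)%N -> (b < p)%N -> a%:R = b%:R :> k -> a = b.
Proof.
wlog le_ab : a b / (a <= b)%N.
  by move=> W ap bp; case: (leqP a b) => [|/ltnW] /W H; [|symmetry]; auto.
move=> _ bp /esym/eqP; rewrite -subr_eq0 -natrB // -(dvdn_pcharf charp).
case: (posnP (b - a)) => [/eqP|ba /(dvdn_leq ba)].
  by rewrite subn_eq0 => ba _; apply/eqP; rewrite eqn_leq le_ab.
by rewrite leqNgt (leq_ltn_trans (leq_subr _ _)).
Qed.

Lemma inj_affine (e : 'I_10 -> k) (d s : k) (F : seq nat) :
  size F = 10 -> uniq F -> all (gtn p) F ->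
  (forall c, d * e c + s = (nth 0%N F c)%:R) -> injective e.
Proof.
move=> szF uF ltF eF c c' ecc'; apply/val_inj/eqP => /=.
rewrite -(nth_uniq 0%N _ _ uF) ?szF //; apply/eqP.
apply: natr_inj_ltp; last by rewrite -!eF ecc'.
- by apply: (allP ltF); rewrite mem_nth ?szF.
- by apply: (allP ltF); rewrite mem_nth ?szF.
Qed.

(** For j <= j' and d = j' - j, equality of two orders reads d n = i - i'. The sign of i - i'
    selects the hypothesis; when i < i', the bound d + (i' - i) <= 3 comes from i' + j' <= 3. *)
Lemma inj_orders (e := fun c : 'I_10 => nth (0, 0)%N cubic_exps c) :
  (forall d a, (0 < d <= 3)%N -> (a <= 3)%N -> d%:R * n%:R <> a%:R :> k) ->
  (forall d a, (0 < d)%N -> (d + a <= 3)%N -> d%:R * n%:R + a%:R <> 0 :> k) ->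
  injective (fun c : 'I_10 => (e c).1%:R + (e c).2%:R * n%:R : k).
Proof.
move=> Hsub Hadd c c' ecc'; apply/val_inj/eqP => /=.
rewrite -(nth_uniq (0, 0)%N (s := cubic_exps)) //; apply/eqP.
have e3 c0 : ((e c0).1 + (e c0).2 <= 3)%N.
  by case: c0 => -[|[|[|[|[|[|[|[|[|[|m]]]]]]]]]].
move: (e3 c) (e3 c') ecc'; rewrite -/(e c) -/(e c').
case: (e c) (e c') => [i j] [i' j'] /=.
wlog le_j : i j i' j' / (j <= j')%N.
  move=> W ? ? /esym ?.
  by case: (leqP j j') => [|/ltnW] /W H; [|symmetry]; auto.
move=> le3 le3' ecc'.
have eq_i : i%:R = i'%:R + (j' - j)%:R * n%:R :> k.
  apply: (addIr (j%:R * n%:R)); rewrite ecc' -{1}(subnK le_j) natrD.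
  by rewrite mulrDl addrA.
case: (posnP (j' - j)) eq_i => [d0|d0] eq_i.
  rewrite d0 mul0r addr0 in eq_i.
  have <- : j = j' by apply/eqP; rewrite eqn_leq le_j -subn_eq0 d0.
  congr (_, _).
  have lt_p a b : (a + b <= 3)%N -> (a < p)%N.
    by move=> le; apply: leq_ltn_trans (leq_trans (leq_addr b a) le) _;
       apply: leq_trans p_gt11.
  by apply: natr_inj_ltp eq_i; [apply: lt_p le3 | apply: lt_p le3'].
have le_d : (j' - j <= 3)%N.
  exact: leq_trans (leq_subr _ _) (leq_trans (leq_addl _ _) le3').
case: (leqP i' i) => [le_i|/ltnW le_i].
  case: (Hsub (j' - j)%N (i - i')%N); first by rewrite d0.
    exact: leq_trans (leq_subr _ _) (leq_trans (leq_addr _ _) le3).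
  by rewrite [(i - i')%:R]natrB // eq_i addrC addKr.
case: (Hadd (j' - j)%N (i' - i)%N) => //.
  by apply: leq_trans le3'; rewrite addnC leq_add ?leq_subr.
by rewrite [(i' - i)%:R]natrB // eq_i; ring.
Qed.

(** The variable of the collision polynomials stands for x^n. *)
Definition chart_eval : {rmorphism {poly k} -> L} :=
  horner_eval (x ^+ n) \o map_poly iota.

Lemma eval_comp_Xn i (P : {poly k}) :
  eval_x _ _ iota x ('X^i * (P \Po 'X^n)) = x ^+ i * chart_eval P.
Proof.
rewrite /eval_x rmorphM rmorphXn /= map_polyX hornerM hornerXn.
by rewrite map_comp_poly map_polyXn horner_comp hornerXn.
Qed.

Lemma chart_evalX : chart_eval 'X = x ^+ n.
Proof. by rewrite /= map_polyX /horner_eval hornerX. Qed.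

Lemma chart_evalZ N :
  chart_eval (1 - (1 - 'X) ^+ N) = eval_x _ _ iota x (chart_z N).
Proof.
by rewrite /eval_x /chart_z map_comp_poly map_polyXn horner_comp hornerXn.
Qed.

Definition chart_evalE :=
  (rmorph_nat chart_eval, rmorphD chart_eval, rmorphN chart_eval,
   rmorphXn chart_eval, rmorphM chart_eval, chart_evalX).

Lemma cspan_chart_z N c i j : (n * N)%:R = 1 :> k -> const _ D c ->
  (i + j <= 3)%N ->
  cspan _ D _ cubic_monomial
    (c * (x ^+ i * eval_x _ _ iota x (chart_z N) ^+ j)).
Proof.
move=> nN cc le3; apply: (cspanM _ _ _ _ _ HD) => //.
by rewrite eval_chart_z //; apply: cspan_chart.
Qed.

(* The affine map e |-> d e + t clears the denominator of n mod p and makes the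
   orders nonnegative: F lists the resulting integers, which are at most 12. *)
Lemma fermat_classical_collision (N : nat) (m0 : 'I_10) (i s : nat)
    (P : {poly k}) (d t : k) (F : seq nat)
    (e := fun c : 'I_10 =>
       if c == m0 then (i, s) else nth (0, 0)%N cubic_exps c) :
  (n * N)%:R = 1 :> k ->
  cspan _ D _ cubic_monomial
    (x ^+ i * chart_eval P) ->
  order0 s P -> size F = 10 -> uniq F -> all (gtn p) F ->
  (forall c : 'I_10,
     d * ((e c).1%:R + (e c).2%:R * n%:R) + t = (nth 0%N F c)%:R) ->
  classical_cubics D x y.
Proof.
move=> nN sP oP szF uF ltF eF.
apply: (fermat_classical N nN m0 ('X^i * (P \Po 'X^n)) (i, s)).
- by rewrite eval_comp_Xn.
- by apply: order0M (order0_Xn _ _) _; apply: order0_comp_Xn.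
- exact: inj_affine szF uF ltF eF.
Qed.

(** 12 is not prime; the bound is needed because the cleared orders reach 12 when n = 3/2. *)
Let p_gt12 : (12 < p)%N.
Proof.
rewrite ltn_neqAle p_gt11 andbT; apply: contraTneq (pcharf_prime charp).
by move=> <-.
Qed.

Let all_gtn F : all (gtn 13) F -> all (gtn p) F.
Proof. by apply: sub_all => a /leq_trans; apply. Qed.

Let natr0 r : (0 < r < 12)%N -> r%:R != 0 :> k.
Proof.
move=> /andP[r0 rp]; apply: (natr_ltp_neq0 p) => //.
by rewrite r0 (leq_trans rp).
Qed.

Let pred_p : p.-1%:R = -1 :> k.
Proof.
apply/eqP; rewrite -subr_eq0 opprK natr1 prednK ?(pcharf0 charp) //.
exact: leq_trans p_gt11.
Qed.

(** * The residues -2, 3/2, -1/2 and 2/3 of n *)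

Lemma fermat_classical_m2 : n%:R = - 2 :> k -> classical_cubics D x y.
Proof.
move=> n2; have [M M2] := pchar_natr_inv _ _ charp 2 (natr0 2 isT).
have nN : (n * (M * p.-1))%:R = 1 :> k.
  by rewrite !natrM n2 pred_p -[RHS]M2 natrM; ring.
(* 1 and x^2 z both have order 0 mod p. Since x^(n+2) is constant, x^2 z can be corrected by 1, z,
   z^2, z^3 to reach order 2 + 5 n = -8. *)
apply: (fermat_classical_collision _ (Ordinal (isT : 7 < 10)%N) 2 5 _ 1 8
  [:: 8; 9; 6; 10; 7; 4; 11; 0; 5; 2]%N nN _
  (order0_collision_m2 _ _ M charp p_gt11 M2)) => //.
- move: (chart_evalZ (M * p.-1)); set Z := 1 - (1 - 'X) ^+ _.
  move: Z => Z; set z := eval_x _ _ _ _ _ => eZ.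
  rewrite !chart_evalE eZ.
  have cc : const _ D (x ^+ (n + 2)).
    by apply: cpow; rewrite (dvdn_pcharf charp) natrD n2; apply/eqP; ring.
  set c := x ^+ (n + 2) in cc.
  have -> : x ^+ 2 * (8 * x ^+ n + 16 * z - 12 * x ^+ n * z
      + 2 * x ^+ n * z ^+ 2 + x ^+ n * z ^+ 3) =
      8 * c * (x ^+ 0 * z ^+ 0) + 16 * (x ^+ 2 * z ^+ 1)
      + (- 12 * c) * (x ^+ 0 * z ^+ 1) + 2 * c * (x ^+ 0 * z ^+ 2)
      + c * (x ^+ 0 * z ^+ 3).
    by rewrite /c exprD; ring.
  by repeat apply: (cspanD _ _ _ _ _ HD); apply: cspan_chart_z => //; constants.
- exact: all_gtn.
- by case=> -[|[|[|[|[|[|[|[|[|[|m]]]]]]]]]] //= _; rewrite n2; ring.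
Qed.

Lemma fermat_classical_3half : 2 * n%:R = 3 :> k -> classical_cubics D x y.
Proof.
move=> n2; have [M M3] := pchar_natr_inv _ _ charp 3 (natr0 3 isT).
have nN : (n * (M * 2))%:R = 1 :> k.
  by rewrite !natrM mulrCA mulrC [n%:R * _]mulrC n2 -natrM.
(* x^3 and z^2 collide at order 3; x^3 is replaced by a combination of x^3, z^2, z^3 of order 4 n =
   6. *)
apply: (fermat_classical_collision _ (Ordinal (isT : 6 < 10)%N) 0 4 _ 2 0
  [:: 0; 2; 3; 4; 5; 6; 12; 7; 8; 9]%N nN _
  (order0_collision_3half _ _ M charp p_gt11 M3)) => //.
- move: (chart_evalZ (M * 2)); set Z := 1 - (1 - 'X) ^+ _.
  move: Z => Z; set z := eval_x _ _ _ _ _ => eZ.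
  rewrite !chart_evalE eZ.
  have le3 : (3 <= 2 * n)%N 
    by apply: leq_trans (ltnW n_gt3) _; rewrite leq_pmull.
  have cc : const _ D (x ^+ (2 * n - 3)).
    apply: cpow; rewrite (dvdn_pcharf charp) natrB // natrM n2.
    by rewrite subrr.
  have ec : x ^+ n ^+ 2 = x ^+ (2 * n - 3) * x ^+ 3.
    by rewrite -exprM mulnC -exprD subnK.
  set c := x ^+ (2 * n - 3) in cc ec.
  have -> : x ^+ 0 * (18 * z ^+ 2 - 9 * z ^+ 3 - 8 * (x ^+ n) ^+ 2) =
      18 * (x ^+ 0 * z ^+ 2) + (- 9) * (x ^+ 0 * z ^+ 3)
      + (- 8 * c) * (x ^+ 3 * z ^+ 0).
    by rewrite ec; ring.
  by repeat apply: (cspanD _ _ _ _ _ HD); apply: cspan_chart_z => //; constants.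
- exact: all_gtn.
- move=> c; rewrite mulrDr mulrCA n2.
  by case: c => -[|[|[|[|[|[|[|[|[|[|m]]]]]]]]]] //= _; ring.
Qed.

Lemma fermat_classical_mhalf : 2 * n%:R = - 1 :> k -> classical_cubics D x y.
Proof.
move=> n2.
have nN : (n * (2 * p.-1))%:R = 1 :> k.
  by rewrite !natrM mulrA [n%:R * _]mulrC n2 pred_p mulN1r opprK.
(* 1 and x z^2 collide at order 0; x z^2 is corrected by 1, z, z^2, z^3 to reach order 1 + 6 n =
   -2. *)
apply: (fermat_classical_collision _ (Ordinal (isT : 8 < 10)%N) 1 6 _ 2 4
  [:: 4; 6; 3; 8; 5; 2; 10; 7; 0; 1]%N nN _
  (order0_collision_mhalf _ _ charp p_gt11)) => //.
- move: (chart_evalZ (2 * p.-1)); set Z := 1 - (1 - 'X) ^+ _.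
  move: Z => Z; set z := eval_x _ _ _ _ _ => eZ.
  rewrite !chart_evalE eZ.
  have cc : const _ D (x ^+ (n * 2 + 1)).
    apply: cpow; rewrite (dvdn_pcharf charp) natrD natrM mulrC n2.
    by rewrite addNr.
  set c := x ^+ (n * 2 + 1) in cc.
  have -> : x ^+ 1 * (8 * z ^+ 2 - (x ^+ n) ^+ 2 *
       (32 - 48 * z + 14 * z ^+ 2 + z ^+ 3)) =
      8 * (x ^+ 1 * z ^+ 2) + (- 32 * c) * (x ^+ 0 * z ^+ 0)
      + (48 * c) * (x ^+ 0 * z ^+ 1) + (- 14 * c) * (x ^+ 0 * z ^+ 2)
      + (- c) * (x ^+ 0 * z ^+ 3).
    by rewrite /c exprD exprM; ring.
  by repeat apply: (cspanD _ _ _ _ _ HD); apply: cspan_chart_z => //; constants.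
- exact: all_gtn.
- move=> c; rewrite mulrDr mulrCA n2.
  by case: c => -[|[|[|[|[|[|[|[|[|[|m]]]]]]]]]] //= _; ring.
Qed.

Lemma fermat_classical_2third : 3 * n%:R = 2 :> k -> classical_cubics D x y.
Proof.
move=> n3; have [M M2] := pchar_natr_inv _ _ charp 2 (natr0 2 isT).
have nN : (n * (M * 3))%:R = 1 :> k.
  by rewrite !natrM mulrCA mulrC [n%:R * _]mulrC n3 -natrM.
(* x^2 and z^3 collide at order 2; x^2 is replaced by a combination of x^2, z^3, x^2 z of order 5 n
   = 10/3. *)
apply: (fermat_classical_collision _ (Ordinal (isT : 3 < 10)%N) 0 5 _ 3 0
  [:: 0; 3; 2; 10; 5; 4; 9; 8; 7; 6]%N nN _
  (order0_collision_2third _ _ M charp p_gt11 M2)) => //.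
- move: (chart_evalZ (M * 3)); set Z := 1 - (1 - 'X) ^+ _.
  move: Z => Z; set z := eval_x _ _ _ _ _ => eZ.
  rewrite !chart_evalE eZ.
  have le2 : (2 <= 3 * n)%N by rewrite -[2%N]/(2 * 1)%N leq_mul.
  have cc : const _ D (x ^+ (3 * n - 2)).
    apply: cpow; rewrite (dvdn_pcharf charp) natrB // natrM n3.
    by rewrite subrr.
  have ec : x ^+ n ^+ 3 = x ^+ (3 * n - 2) * x ^+ 2.
    by rewrite -exprM mulnC -exprD subnK.
  set c := x ^+ (3 * n - 2) in cc ec.
  have -> : x ^+ 0 * (54 * (x ^+ n) ^+ 3 - 16 * z ^+ 3
        - 27 * (x ^+ n) ^+ 3 * z) =
      (54 * c) * (x ^+ 2 * z ^+ 0) + (- 16) * (x ^+ 0 * z ^+ 3)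
      + (- 27 * c) * (x ^+ 2 * z ^+ 1).
    by rewrite ec; ring.
  by repeat apply: (cspanD _ _ _ _ _ HD); apply: cspan_chart_z => //; constants.
- exact: all_gtn.
- move=> c; rewrite mulrDr mulrCA n3.
  by case: c => -[|[|[|[|[|[|[|[|[|[|m]]]]]]]]]] //= _; ring.
Qed.

(** * Distinct orders, and the final case analysis *)

Lemma fermat_classical_distinct :
  n%:R != 0 :> k ->
  (forall d a, (0 < d <= 3)%N -> (a <= 3)%N -> d%:R * n%:R <> a%:R :> k) ->
  (forall d a, (0 < d)%N -> (d + a <= 3)%N -> d%:R * n%:R + a%:R <> 0 :> k) ->
  classical_cubics D x y.
Proof.
move=> n0 Hsub Hadd; have [N nN] := pchar_natr_inv _ _ charp n n0.
(* Nothing collides, so the member 1 is replaced by itself. *)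
apply: (fermat_classical N nN (Ordinal (isT : 0 < 10)%N) 1 (0, 0)%N).
- rewrite /eval_x rmorph1 hornerC -[1]mulr1 -{1}(expr0 x) -(expr0 y).
  exact: cspan_monomial.
- by apply: order0_unit; rewrite hornerC oner_neq0.
- move=> c c' ecc'; apply: (inj_orders Hsub Hadd) => /=; move: ecc' => /=.
  by case: eqP => [->|_]; case: eqP => [->|_].
Qed.

End FermatCurve.

Theorem theorem3p8 (p n : nat) (k : closedFieldType) (L : fieldType)
  (iota : {rmorphism k -> L}) (x y : L) (D : nat -> L -> L) :
  prime p -> (11 < p)%N -> (3 < n)%N -> ~~ (p %| n)%N ->
  is_closure_of_Fp p k ->
  x ^+ n + y ^+ n = 1 ->
  transcendental_over iota x ->
  hasse_derivatives iota x D ->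
  (~ classical_cubics D x y <->
   (p %| (n - 2) * (n - 1) * (n + 1) * (2 * n - 1) * (n - 3) * (3 * n - 1))%N).
Proof.
move=> pr_p p_gt11 n_gt3 ndvd_n [charp _] curve trx HD.
rewrite !Euclid_dvdM //; split; last first.
  move=> dv; apply: (fermat_nonclassical p n k L iota x y D) => //.
  case/orP: dv => [|]; last by right; constructor 3.
  case/orP => [|]; last by left; constructor 3.
  case/orP => [|]; last by right; constructor 2.
  case/orP => [|]; last by right; constructor 1.
  by case/orP => [|]; left; [constructor 2 | constructor 1].
apply: contra_notT; rewrite !negb_or !(dvdn_pcharf charp).
rewrite !natrB ?muln_gt0 ?(leq_trans _ n_gt3) // !natrM natrD !subr_eq0.
move=> /andP[/andP[/andP[/andP[/andP[n2 n1] nm1] h2] n3] h3].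
rewrite (dvdn_pcharf charp) in ndvd_n.
have small r : (0 < r < 12)%N -> r%:R != 0 :> k.
  move=> /andP[r0 rp]; apply: (natr_ltp_neq0 p) => //.
  by rewrite r0 (leq_trans rp).
have [/eqP m2|m2] := boolP (n%:R == - 2 :> k).
  exact: (fermat_classical_m2 p n k L iota x y D).
have [/eqP q3|q3] := boolP (2 * n%:R == 3 :> k).
  exact: (fermat_classical_3half p n k L iota x y D).
have [/eqP qm|qm] := boolP (2 * n%:R == - 1 :> k).
  exact: (fermat_classical_mhalf p n k L iota x y D).
have [/eqP r2|r2] := boolP (3 * n%:R == 2 :> k).
  exact: (fermat_classical_2third p n k L iota x y D).
apply: (fermat_classical_distinct p n k L iota x y D) => //.
(* The fractions a/d are 0, 1, 2, 3, 1/2, 3/2, 1/3, 2/3, all excluded; those with d > 1 and a = 0 or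
   a = d first have to be reduced. *)
- case=> [|[|[|[|d]]]] // [|[|[|[|a]]]] // _ _ /eqP;
    rewrite ?mul1r; apply/negP => //.
  + by rewrite mulf_neq0 // small.
  + by rewrite -[X in _ != X]mulr1 (inj_eq (mulfI _)) // small.
  + by rewrite mulf_neq0 // small.
  + by rewrite -[X in _ != X]mulr1 (inj_eq (mulfI _)) // small.
(* The bound d + a <= 3 leaves only n = 0, -1, -2, -1/2. *)
- case=> [|[|[|[|d]]]] // [|[|[|a]]] // _ _ /eqP;
    rewrite ?mul1r ?addr0 ?addr_eq0; apply/negP => //.
  + by rewrite addr_eq0 in nm1.
  + by rewrite mulf_neq0 // small.
  + by rewrite mulf_neq0 // small.
Qed.
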